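(* Let $R$ be an associative ring with unity $1$ and let $a,b,c,v,w\in R$ with at least one of $v$, $w$ invertible. Assume that $rann(vawb)=rann(b)=rann(c)$. Then the hybrid $(v,w)$-weighted $(b,c)$-inverse of $a$ exists if and only if $vawb$ is group invertible.
   Context: For $x\in R$: $xR=\{xr: r\in R\}$ and $rann(x)=\{z\in R: xz=0\}$. An element $y\in R$ is the hybrid $(v,w)$-weighted $(b,c)$-inverse of $a$ if $yvawy=y$, $yvR=bR$ and $rann(c)=rann(wy)$. An element $x\in R$ is group invertible if there is $z\in R$ with $xzx=x$, $zxz=z$ and $xz=zx$. *)

(* Defs.v *)
From mathcomp Require Import all_boot all_algebra.
From mathcomp Require Import classical_sets.

Set Implicit Arguments.
Unset Strict Implicit.
Unset Printing Implicit Defensive.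

Import GRing.Theory.
Local Open Scope classical_set_scope.
Local Open Scope ring_scope.

(* Rings are pzRingType: associative, unital, possibly trivial and with no
   decidability of units, whence the explicit two-sided [invertible]. *)

Definition rideal (R : pzRingType) (x : R) : set R := [set x * r | r in setT].

Definition rann (R : pzRingType) (x : R) : set R := [set z | x * z = 0].

Definition invertible (R : pzRingType) (x : R) : Prop :=
  exists z : R, z * x = 1 /\ x * z = 1.

Definition group_invertible (R : pzRingType) (x : R) : Prop :=
  exists z : R, [/\ x * z * x = x, z * x * z = z & x * z = z * x].

Definition is_hybrid_weighted_inverse (R : pzRingType) (v w b c a y : R)
    : Prop :=
  [/\ y * v * a * w * y = y,
      rideal (y * v) = rideal b
    & rann c = rann (w * y)].

(* Main.v *)
(* Put p = vawb. If z is the group inverse of p, then p(1 - zp) = 0 forces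
   b = bzp, and y = bz is the hybrid inverse. Conversely, a hybrid inverse y
   factors as y = bu (since y = (yv)awy and yvR = bR), and the annihilator
   conditions give pup = p, ppu = p and puup = pu, so that puu is the group
   inverse of p. *)

Require Import Defs.
From mathcomp Require Import all_boot all_algebra.
From mathcomp Require Import classical_sets.

Local Open Scope classical_set_scope.
Local Open Scope ring_scope.

Import GRing.Theory.

(** The difference [s - t] lies in [rann x]. Inclusions of annihilators thus serve to change the
    left factor of an equality. *)
Lemma eq_mul_rann_sub (R : pzRingType) (x y s t : R) :
  rann x `<=` rann y -> x * s = x * t -> y * s = y * t.
Proof.
move=> sub_xy eq_st; apply/eqP; rewrite -subr_eq0 -mulrBr; apply/eqP.
by apply: sub_xy; rewrite /rann /= mulrBr eq_st subrr.
Qed.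

(** With [z = p * u * u], both [p * z] and [z * p] collapse to [p * u]. *)
Lemma group_invertible_mul_sqr (R : pzRingType) (p u : R) :
  p * u * p = p -> p * p * u = p -> p * u * u * p = p * u ->
  group_invertible p.
Proof.
move=> pup ppu puup; exists (p * u * u).
have pz : p * (p * u * u) = p * u by rewrite !mulrA ppu.
split; first by rewrite pz.
  by rewrite puup !mulrA pup.
by rewrite pz puup.
Qed.

Section HybridInverse.
Variables (R : pzRingType) (a b c v w : R).
Let p := v * a * w * b.
Hypothesis rann_p : rann p = rann b.
Hypothesis rann_b : rann b = rann c.

Lemma hybrid_inverse_of_group_inverse (z : R) :
  p * z * p = p -> z * p * z = z -> p * z = z * p ->
  is_hybrid_weighted_inverse v w b c a (b * z).
Proof.
move=> pzp zpz pzC.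
have bzp : b * (z * p) = b.
  rewrite -[RHS]mulr1; apply: (@eq_mul_rann_sub _ p); first by rewrite rann_p.
  by rewrite mulrA pzp mulr1.
split.
- by rewrite -[in RHS]zpz /p !mulrA.
- rewrite /rideal; apply/seteqP; split=> _ [r _ <-].
    by exists (z * v * r) => //; rewrite !mulrA.
  by exists (a * w * b * r) => //; rewrite -[in RHS]bzp /p !mulrA.
- rewrite -rann_b; apply/seteqP; split=> x; rewrite /rann /= => x0.
    have -> : z = z * z * p by rewrite -[LHS]zpz -mulrA pzC mulrA.
    by rewrite /p -!mulrA x0 !mulr0.
  (* Commuting [z] past [p] in [b = b * (z * p)] puts [w * (b * z)] directly in front of [x]. *)
  have -> : b * x = b * (v * a * (w * (b * z) * x)).
    by rewrite -[in LHS]bzp -pzC /p !mulrA.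
  by rewrite x0 !mulr0.
Qed.

Lemma group_invertible_of_hybrid_inverse (y : R) :
  is_hybrid_weighted_inverse v w b c a y -> group_invertible p.
Proof.
case=> yvawy yvR; rewrite -rann_b => rann_wy.
have [s _ yvs] : rideal (y * v) b by rewrite yvR; exists 1; rewrite ?mulr1.
have [t _ bt] : rideal b (y * v) by rewrite -yvR; exists 1; rewrite ?mulr1.
pose u := t * a * w * y.
have yE : y = b * u by rewrite /u !mulrA bt yvawy.
have bup : b * u * p = b by rewrite -yE /p -yvs !mulrA yvawy.
(* As [b * u = y], the equation [y * v * a * w * y = y] says that [w * y] fixes [p * u] to
   [w * y * 1]; the left factor [w * y] is then traded for [b]. *)
have bpu : b * p * u = b.
  rewrite -mulrA -[RHS]mulr1; apply: (@eq_mul_rann_sub _ (w * y)).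
    by rewrite rann_wy.
  by rewrite mulr1 /p -(mulrA _ b u) -yE -mulrA; congr (w * _); rewrite !mulrA.
have pM x : p * x = v * a * w * (b * x) by rewrite /p !mulrA.
have pup : p * u * p = p.
  by rewrite -[LHS]mulrA [LHS]pM [b * (u * p)]mulrA bup.
have ppu : p * p * u = p.
  by rewrite -[LHS]mulrA [LHS]pM [b * (p * u)]mulrA bpu.
(* Both [p * (u * p)] and [p * (p * u)] equal [p]. The left factor [p] is traded for [w * y], and
   multiplying by [v * a] turns that into [p * u]. *)
have puup : p * u * (u * p) = p * u * (p * u).
  have puE : p * u = v * a * (w * y) by rewrite pM -yE !mulrA.
  have sub_wy : rann p `<=` rann (w * y) by rewrite rann_p rann_wy.
  rewrite {1 2}puE -![v * a * (w * y) * _]mulrA; congr (_ * _).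
  by apply: (eq_mul_rann_sub _ p _ _ _ sub_wy); rewrite [LHS]mulrA [RHS]mulrA pup ppu.
apply: (group_invertible_mul_sqr _ _ u pup ppu).
by rewrite -[LHS]mulrA puup [LHS]mulrA pup.
Qed.

End HybridInverse.

Theorem theorem4p6 (R : pzRingType) (a b c v w : R)
  (hvw : invertible v \/ invertible w)
  (hb : rann (v * a * w * b) = rann b)
  (hc : rann b = rann c) :
  (exists y : R, is_hybrid_weighted_inverse v w b c a y) <->
  group_invertible (v * a * w * b).
Proof.
split=> [[y]|[z [pzp zpz pzC]]].
  exact: group_invertible_of_hybrid_inverse.
by exists (b * z); apply: hybrid_inverse_of_group_inverse.
Qed.
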